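(* Let $\epsilon>0$ and let $\alpha$ be an irrational number of type $<\psi$, where $\psi(q)=\exp(q^{1/(3+\epsilon)})$. Then $$D_N(\alpha)=O\left(\frac{1}{\ln^{3+\epsilon/3}N}\right)\quad (N\to\infty).$$
   Context: For a real number $t$, $\langle t\rangle=\min_{n\in\mathbb{Z}}|t-n|$ denotes the distance from $t$ to the nearest integer. If $\psi$ is a non-decreasing positive function defined on the positive integers, an irrational number $\alpha$ is said to be of type $<\psi$ if $q\langle q\alpha\rangle\ge 1/\psi(q)$ for all positive integers $q$. For a sequence $\omega=(x_n)_{n\ge1}$ in $[0,1)$ and $E\subset[0,1)$, let $A(N,E,\omega)$ be the number of $n$ with $1\le n\le N$ and $x_n\in E$, and $$D_N(\omega)=\sup_{0\le a<b\le1}\left|\frac{A(N,[a,b),\omega)}{N}-(b-a)\right|.$$ $D_N(\alpha)$ denotes the discrepancy $D_N(\omega)$ of the sequence $\omega=(\{n\alpha\})_{n\ge1}$, where $\{\cdot\}$ is the fractional part. *)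

(* Defs.v *)
From mathcomp Require Import all_boot all_order all_algebra.
From mathcomp Require Import all_classical all_reals all_analysis.

Set Implicit Arguments.
Unset Strict Implicit.
Unset Printing Implicit Defensive.

Import Order.TTheory GRing.Theory Num.Theory.
Import numFieldNormedType.Exports.

Local Open Scope classical_set_scope.
Local Open Scope ring_scope.

Section Discrepancy.
Variable R : realType.
Implicit Types (t alpha eps a b : R) (omega : nat -> R) (E : set R) (N q : nat).

(* The infimum is a minimum: see [dist_intP]. *)
Definition dist_int t : R := inf (range (fun n : int => `|t - n%:~R|)).

(* [psi] is only used at positive integers; the standing assumption that it is
   positive and non-decreasing there is [admissible], which holds for
   [psi_exp eps] by [admissible_psi_exp]. *)
Definition of_type_lt (psi : nat -> R) alpha : Prop :=
  irrational alpha /\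
  forall q, (0 < q)%N -> 1 / psi q <= q%:R * dist_int (q%:R * alpha).

Definition admissible (psi : nat -> R) : Prop :=
  (forall q, (0 < q)%N -> 0 < psi q) /\
  (forall p q, (0 < p)%N -> (p <= q)%N -> psi p <= psi q).

Definition psi_exp eps q : R := expR (q%:R `^ (1 / (3 + eps))).

(* Sequences are indexed from 1: the value [omega 0] is never used. *)
Definition counting_number N E omega : nat :=
  (\sum_(1 <= n < N.+1 | omega n \in E) 1)%N.

Definition deviations N omega : set R :=
  [set d | exists a b, [/\ 0 <= a, a < b, b <= 1 &
     d = `|(counting_number N `[a, b[ omega)%:R / N%:R - (b - a)|]].

(* The supremum is a genuine one: see [has_sup_deviations]. *)
Definition discrepancy N omega : R := sup (deviations N omega).

Definition frac_part t : R := t - (Num.floor t)%:~R.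

Definition kronecker_discrepancy N alpha : R :=
  discrepancy N (fun n => frac_part (n%:R * alpha)).

Lemma dist_intP t :
  (exists n : int, dist_int t = `|t - n%:~R|) /\
  (forall n : int, dist_int t <= `|t - n%:~R|).
Proof.
have lbD : lbound (range (fun n : int => `|t - n%:~R|)) 0.
  by move=> _ [n _ <-].
have le_d n : dist_int t <= `|t - n%:~R|.
  by apply: ge_inf; [exists 0 | exists n].
split=> //; set f := Num.floor t.
have fle : f%:~R <= t by exact: floor_le.
have ltf : t < (f + 1)%:~R by exact: floorD1_gt.
have low (n : int) : `|t - f%:~R| <= `|t - n%:~R| \/
    `|t - (f + 1)%:~R| <= `|t - n%:~R|.
  have [nf|fn] := leP n f; [left|right].
    have nf' : n%:~R <= f%:~R :> R by rewrite ler_int.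
    by rewrite !ger0_norm ?subr_ge0 ?(le_trans nf')// lerD2l lerN2.
  have fn' : (f + 1)%:~R <= n%:~R :> R by rewrite ler_int lezD1.
  have tf : t <= (f + 1)%:~R by exact: ltW.
  by rewrite !ler0_norm ?subr_le0// ?(le_trans tf)// !opprB lerD2r.
have ne : range (fun n : int => `|t - n%:~R|) !=set0.
  by exists `|t - 0%:~R|; exists 0.
have [le1|le2] := leP `|t - f%:~R| `|t - (f + 1)%:~R|.
  exists f; apply/eqP; rewrite eq_le le_d/=; apply: lb_le_inf => // _ [n _ <-].
  by case: (low n) => // ?; exact: le_trans le1 _.
exists (f + 1); apply/eqP; rewrite eq_le le_d/=.
apply: lb_le_inf => // _ [n _ <-].
by case: (low n) => // ?; exact: le_trans (ltW le2) _.
Qed.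

Lemma admissible_psi_exp eps : 0 < eps -> admissible (psi_exp eps).
Proof.
move=> eps0; split=> [q _|p q _ pq]; first exact: expR_gt0.
rewrite ler_expR; apply: ge0_ler_powR; rewrite ?nnegrE ?ler0n ?ler_nat//.
by rewrite divr_ge0// addr_ge0// ltW.
Qed.

Lemma has_sup_deviations N omega : has_sup (deviations N omega).
Proof.
split; first by eexists; exists 0, 1; rewrite lexx ltr01 lexx.
exists 1 => _ [a [b [a0 ab b1 ->]]].
have ba0 : 0 <= b - a by rewrite subr_ge0 ltW.
have ba1 : b - a <= 1 by rewrite lerBlDr (le_trans b1)// lerDl.
set c := (_ / _).
have c0 : 0 <= c by rewrite divr_ge0.
have c1 : c <= 1.
  rewrite /c; case: N @c c0 => [|N] _ _; first by rewrite invr0 mulr0.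
  rewrite ler_pdivrMr ?ltr0n// mul1r ler_nat /counting_number.
  rewrite big_mkcond (leq_trans (n := \sum_(1 <= n < N.+2) 1)%N)//.
    by apply: leq_sum => i _; case: ifP.
  by rewrite sum_nat_const_nat muln1 subn1.
rewrite ler_norml; apply/andP; split.
  by rewrite lerBrDr addrC (le_trans _ c0)// subr_le0.
by rewrite lerBlDr (le_trans c1)// lerDl.
Qed.

End Discrepancy.

(* Main.v *)
Require Import Defs.
From mathcomp Require Import all_boot all_order all_algebra.
From mathcomp Require Import all_classical all_reals all_analysis.
From mathcomp Require Import ring lra zify.

Set Implicit Arguments.
Unset Strict Implicit.
Unset Printing Implicit Defensive.

Import Order.TTheory GRing.Theory Num.Theory.
Import numFieldNormedType.Exports.
Local Open Scope classical_set_scope.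
Local Open Scope ring_scope.

(** For each [N], a single good rational approximation of [alpha] controls the
first [N] points.

Take [Q] to be the integer part of the square root of [N].  Dirichlet's theorem
([dirichlet_approximation]) gives coprime [q <= Q] and [p] such that
[q * alpha] lies within [1/Q <= 1/q] of [p].  Over any [q] consecutive indices,
[n * alpha] modulo 1 is then, up to an error of at most [1/q], a translate of
the [q] equally spaced points [j/q].  So an interval of length [l] receives
[q * l + O(1)] of these [q] points ([count_block]); adding up about [N/q]
blocks, the incomplete last one costing at most [q <= N/q], gives
[D_N(alpha) <= 14/q] ([kronecker_discrepancy_le]).

It remains to see that [q] is large, and this is what the type of [alpha]
provides: [1/psi(q) <= q * <q alpha> <= q/Q], that is [Q <= q * psi(q)].  Taking
logarithms, [ln N] is at most a constant times [q^(1/(3+eps))]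
([ln_le_type_denominator]), hence [(ln N)^(3+eps) = O(q)].  This is stronger
than what is claimed, since [3 + eps/3 <= 3 + eps]. *)

(** * Rational approximation *)

Lemma frac_part_itv (R : realType) (t : R) : 0 <= frac_part t < 1.
Proof.
rewrite /frac_part subr_ge0 floor_le /= ltrBlDl.
by have := floorD1_gt t; rewrite intrD.
Qed.

(** Among the [Q + 1] fractional parts of [k * alpha], [0 <= k <= Q], two fall in
the same of the [Q] intervals [[b/Q, (b+1)/Q[]; their indices differ by [q]. *)
Lemma pigeonhole_approximation (R : realType) (alpha : R) (Q : nat) :
  (0 < Q)%N ->
  exists q (p : int), [/\ (0 < q)%N, (q <= Q)%N &
    `|q%:R * alpha - p%:~R| < Q%:R^-1].
Proof.
move=> Q0; have Q0R : 0 < Q%:R :> R by rewrite ltr0n.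
pose box (k : nat) := Num.trunc (Q%:R * frac_part (k%:R * alpha)).
have box_itv k : (box k)%:R <= Q%:R * frac_part (k%:R * alpha) < (box k).+1%:R.
  apply: truncn_itv; rewrite mulr_ge0 ?ler0n//.
  by have /andP[] := frac_part_itv (k%:R * alpha).
have box_lt k : (box k < Q)%N.
  have /andP[f0 f1] := frac_part_itv (k%:R * alpha).
  rewrite truncn_lt_nat; last by rewrite mulr_ge0 ?ler0n.
  by rewrite -[ltRHS]mulr1 ltr_pM2l.
pose F (k : 'I_Q.+1) := Ordinal (box_lt k).
have /injectivePn[i0 [j0 ij0 Fij0]] : ~~ injectiveb F.
  apply/negP => /injectiveP /leq_card.
  by rewrite !card_ord ltnn.
have [i [j [ij jQ bij]]] :
    exists i j : nat, [/\ (i < j)%N, (j <= Q)%N & box i = box j].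
  have bij0 : box i0 = box j0 by case: Fij0.
  have [lt|lt|/val_inj e] := ltngtP (val i0) (val j0).
  - by exists i0, j0; split => //; rewrite -ltnS ltn_ord.
  - by exists j0, i0; split => //; rewrite -ltnS ltn_ord.
  - by rewrite e eqxx in ij0.
exists (j - i)%N, (Num.floor (j%:R * alpha) - Num.floor (i%:R * alpha)).
split; [by rewrite subn_gt0 | exact: leq_trans (leq_subr _ _) jQ |].
rewrite natrB ?(ltnW ij)// intrB.
have -> : (j%:R - i%:R) * alpha -
    ((Num.floor (j%:R * alpha))%:~R - (Num.floor (i%:R * alpha))%:~R) =
    frac_part (j%:R * alpha) - frac_part (i%:R * alpha).
  by rewrite /frac_part; ring.
have := box_itv i; have := box_itv j; rewrite bij -natr1.
set b := (box j)%:R; set x := frac_part _; set y := frac_part _.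
move=> /andP[h1 h2] /andP[h3 h4].
rewrite -(ltr_pM2l Q0R) divff ?gt_eqF// -{1}(gtr0_norm Q0R) -normrM ltr_norml.
by rewrite mulrBr; lra.
Qed.

(** Dividing [q] and [p] by their gcd only decreases [|q * alpha - p|], so the
approximation can be taken in lowest terms. *)
Lemma dirichlet_approximation (R : realType) (alpha : R) (Q : nat) :
  (0 < Q)%N ->
  exists q (p : int), [/\ (0 < q)%N, (q <= Q)%N, coprimez q p &
    `|q%:R * alpha - p%:~R| < Q%:R^-1].
Proof.
move=> /(pigeonhole_approximation alpha)[q [p [q0 qQ qp]]].
have /dvdzP[q' q'E] := dvdz_gcdl q p.
have /dvdzP[p' p'E] := dvdz_gcdr q p.
set d := gcdz q p in q'E p'E.
have d0 : 0 < d by rewrite /d /gcdz ltz_nat gcdn_gt0 q0.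
have q'0 : 0 < q' by rewrite -(pmulr_lgt0 _ d0) -q'E.
exists `|q'|%N, p'; have q'a : `|q'|%N = q' :> int by apply: gtz0_abs.
split.
- by rewrite absz_gt0 gt_eqF.
- apply: leq_trans qQ; suff : `|q'|%N <= q :> int by [].
  by rewrite q'a q'E ler_peMr// ltW.
- rewrite q'a /coprimez -(inj_eq (mulIf (lt0r_neq0 d0))) mul1r.
  by rewrite -{1}(gtz0_abs d0) mulz_gcdl -q'E -p'E.
- apply: le_lt_trans qp.
  have -> : q%:R = (q'%:~R * d%:~R : R) by rewrite -intrM -q'E.
  have -> : `|q'|%N%:R = (q'%:~R : R) by rewrite -{2}q'a.
  rewrite [in leRHS]p'E intrM mulrAC -mulrBl normrM ler_peMr//.
  by rewrite gtr0_norm ?ltr0z// ler1z.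
Qed.

(** * Counting visits to an interval *)

(** An interval of length [L] contains at most [L + 1] integers; this turns an
injective labelling by integers into a bound on a number of indices. *)
Lemma count_inj_le (R : realType) (T : eqType) (s : seq T) (P : pred T)
    (M : T -> int) (x L : R) :
  uniq s -> 0 <= L -> {in s &, injective M} ->
  (forall n, n \in s -> P n -> x <= (M n)%:~R <= x + L) ->
  (count P s)%:R <= L + 1.
Proof.
move=> us L0 injM MP; pose c := Num.ceil x.
have bnd n : n \in [seq n <- s | P n] -> 0 <= M n - c /\ (M n - c)%:~R <= L.
  rewrite mem_filter => /andP[Pn ns]; have /andP[xM Mx] := MP n ns Pn.
  rewrite subr_ge0 ceil_le_int xM intrB; split => //.
  by have := ceil_ge x; rewrite -/c; lra.
rewrite -size_filter -(size_map (fun n => `|M n - c|%N)).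
set t := map _ _.
suff : (size t <= size (iota 0 (Num.trunc L).+1))%N.
  rewrite size_iota -(ler_nat R) => /le_trans; apply.
  by rewrite -natr1 lerD2r; have /andP[] := truncn_itv L0.
apply: uniq_leq_size.
  rewrite map_inj_in_uniq ?filter_uniq// => n m nf mf.
  have [n0 _] := bnd n nf; have [m0 _] := bnd m mf => e.
  move: nf mf; rewrite !mem_filter => /andP[_ ns] /andP[_ ms].
  apply: injM => //; apply: (addIr (- c)).
  by rewrite -(gez0_abs n0) -(gez0_abs m0) e.
move=> _ /mapP[n nf ->]; rewrite mem_iota add0n ltnS leq0n /=.
have [n0 nL] := bnd n nf.
by rewrite truncn_ge_nat// (le_trans _ nL)// -[in leRHS](gez0_abs n0).
Qed.

Definition visits (R : realType) (alpha a b : R) : pred nat :=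
  fun n => a <= frac_part (n%:R * alpha) < b.

Section RationalBlocks.
Variables (R : realType) (alpha : R) (q : nat) (p : int).
Hypotheses (q0 : (0 < q)%N) (qp : coprimez q p).
Hypothesis approx : `|q%:R * alpha - p%:~R| <= q%:R^-1.

(** Label the index [n] by [M n = (n - m) * p - q * floor (n * alpha)].  Modulo [q]
this is [(n - m) * p], so the labels of [q] consecutive indices are distinct as
[p] is prime to [q].  On the other hand [M n / q] is the fractional part of
[n * alpha], translated by [- m * alpha] and perturbed by at most [1/q], so a
visit to [[a, b[] confines [M n] to an interval of length [q * (b - a) + 2]. *)
Lemma count_block (a b : R) (m : nat) : a <= b ->
  (count (visits alpha a b) (iota m q))%:R <= q%:R * (b - a) + 3.
Proof.
move=> ab; have q0R : 0 < q%:R :> R by rewrite ltr0n.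
pose M (n : nat) : int := (n%:Z - m%:Z) * p - q%:Z * Num.floor (n%:R * alpha).
have -> : q%:R * (b - a) + 3 = (q%:R * (b - a) + 2) + 1 :> R by ring.
apply: (@count_inj_le _ _ _ _ M (q%:R * (a - m%:R * alpha) - 1)).
- exact: iota_uniq.
- by rewrite addr_ge0 ?mulr_ge0 ?subr_ge0.
- move=> i j; rewrite !mem_iota => /andP[mi iq] /andP[mj jq] e.
  (* Equal labels force [q] to divide [i - j], whereas [|i - j| < q]. *)
  have : (q%:Z %| (i%:Z - j%:Z) * p)%Z.
    apply/dvdzP; exists (Num.floor (i%:R * alpha) - Num.floor (j%:R * alpha)).
    by move: e; rewrite /M; lia.
  rewrite Gauss_dvdzl// => /dvdzP[k kE].
  have k1 : `|k| < 1 by nia.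
  by nia.
- move=> n; rewrite mem_iota => /andP[mn nq] /andP[].
  rewrite /frac_part.
  set f := Num.floor _ => an nb.
  pose e := (n%:R - m%:R) * (q%:R * alpha - p%:~R).
  have e1 : `|e| <= 1.
    rewrite normrM; apply: (@le_trans _ _ (q%:R * q%:R^-1)); last first.
      by rewrite divff ?lt0r_neq0.
    apply: ler_pM => //.
    by rewrite -natrB// normr_nat ler_nat; lia.
  have ME : (M n)%:~R = q%:R * (n%:R * alpha - f%:~R) - q%:R * (m%:R * alpha) - e.
    by rewrite /M /e -/f intrB !intrM intrB; ring.
  rewrite ME.
  have h1 : q%:R * a <= q%:R * (n%:R * alpha - f%:~R) by rewrite ler_pM2l.
  have h2 : q%:R * (n%:R * alpha - f%:~R) <= q%:R * b.
    by rewrite ler_pM2l// ltW.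
  move: e1; rewrite ler_norml => /andP[e1 e2].
  rewrite !mulrBr; lra.
Qed.

Lemma count_blocks (a b : R) (k m : nat) : a <= b ->
  (count (visits alpha a b) (iota m (k * q)))%:R <=
  k%:R * (q%:R * (b - a) + 3).
Proof.
move=> ab; elim: k m => [|k IH] m; first by rewrite mul0n mul0r.
rewrite mulSn iotaD count_cat natrD -natr1 mulrDl mul1r addrC.
by rewrite lerD ?count_block.
Qed.

(** Completing the last block enlarges the count, so [N] may be replaced by the
next multiple of [q].  The condition [q ^ 2 <= N] makes the [q] extra terms, like
the [O(1)] error of each block, contribute [O(N/q)]: the constant is
[1 + 3 * 2]. *)
Lemma count_visits_le (N : nat) (a b : R) : (q ^ 2 <= N)%N ->
    0 <= a -> a <= b -> b <= 1 ->
  (count (visits alpha a b) (iota 1 N))%:R <= N%:R * (b - a) + 7 * (N%:R / q%:R).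
Proof.
move=> qN a0 ab b1; have q0R : 0 < q%:R :> R by rewrite ltr0n.
pose k := (N %/ q)%N.
have Nk : (N < k.+1 * q)%N by rewrite ltn_ceil.
have kN : (k * q <= N)%N by apply: leq_trunc_div.
have step : (count (visits alpha a b) (iota 1 N))%:R <=
    k.+1%:R * (q%:R * (b - a) + 3) :> R.
  apply: le_trans (count_blocks k.+1 1 ab).
  by rewrite ler_nat -(subnKC (ltnW Nk)) iotaD count_cat leq_addr.
apply: le_trans step _.
set X := N%:R / q%:R.
have kX : k%:R <= X by rewrite ler_pdivlMr// -natrM ler_nat.
have qX : q%:R <= X by rewrite ler_pdivlMr// -natrM ler_nat mulnn.
have q1 : 1 <= q%:R :> R by rewrite ler1n.
have kq : k%:R * q%:R <= N%:R :> R by rewrite -natrM ler_nat.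
rewrite -natr1.
have h1 : (k%:R * q%:R) * (b - a) <= N%:R * (b - a).
  by rewrite ler_wpM2r// subr_ge0.
have h2 : q%:R * (b - a) <= q%:R by rewrite ler_piMr ?ler0n//; lra.
by nra.
Qed.

(** The lower bound follows from the upper bound applied to the two complementary
intervals [[0, a[] and [[b, 1[], since every fractional part lies in one of the
three; this is why the error doubles. *)
Lemma count_visits_near (N : nat) (a b : R) : (q ^ 2 <= N)%N ->
    0 <= a -> a <= b -> b <= 1 ->
  `|(count (visits alpha a b) (iota 1 N))%:R - N%:R * (b - a)| <=
  14 * (N%:R / q%:R).
Proof.
move=> qN a0 ab b1.
have cab := count_visits_le qN a0 ab b1.
have c0a := count_visits_le qN (lexx _) a0 (le_trans ab b1).
have cb1 := count_visits_le qN (le_trans a0 ab) b1 (lexx _).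
have : (N <= count (visits alpha a b) (iota 1 N) +
   (count (visits alpha 0 a) (iota 1 N) +
    count (visits alpha b 1) (iota 1 N)))%N.
  rewrite -[leqLHS](size_iota 1 N); elim: (iota 1 N) => [|n s] //=.
  suff : (1 <= visits alpha a b n + (visits alpha 0 a n + visits alpha b 1 n))%N.
    by lia.
  rewrite /visits; have /andP[-> ->] := frac_part_itv (n%:R * alpha).
  set y := frac_part _; rewrite andbT /=.
  by case: (leP a y); case: (leP b y).
rewrite -(ler_nat R) !natrD => cN.
have X0 : 0 <= N%:R / q%:R :> R by rewrite divr_ge0.
by rewrite ler_norml; apply/andP; split; nra.
Qed.

Lemma kronecker_discrepancy_le (N : nat) : (q ^ 2 <= N)%N ->
  kronecker_discrepancy N alpha <= 14 / q%:R.
Proof.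
move=> qN; have q0R : 0 < q%:R :> R by rewrite ltr0n.
have N0 : 0 < N%:R :> R by rewrite ltr0n (leq_trans _ qN)// expn_gt0 q0.
apply: ge_sup; first by case: (has_sup_deviations N (fun n => frac_part (n%:R * alpha))).
move=> _ [a [b [a0 ab b1 ->]]].
have -> : counting_number N `[a, b[ (fun n => frac_part (n%:R * alpha)) =
    count (visits alpha a b) (iota 1 N).
  rewrite /counting_number sum1_count /index_iota subn1.
  apply: eq_count => n; rewrite /visits.
  by apply/idP/idP; rewrite inE/= in_itv.
have := count_visits_near qN a0 (ltW ab) b1.
set c := _%:R => h.
rewrite -(ler_pM2l N0) -{1}(gtr0_norm N0) -normrM mulrBr mulrCA divff ?gt_eqF// mulr1.
by apply: le_trans h _; rewrite mulrCA.
Qed.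

End RationalBlocks.

(** * Denominators of good approximations *)

(** From [N < (Q + 1)^2 <= (2 * Q)^2] one gets [ln N <= 2 * (ln 2 + ln q + y)] with
[y = q^(1/(3+eps)) >= 1], and [ln q = (3 + eps) * ln y] is itself [O(y)]. *)
Lemma ln_le_type_denominator (R : realType) (eps : R) (N Q q : nat) : 0 < eps ->
  (0 < q)%N -> (0 < Q)%N -> (N < Q.+1 ^ 2)%N -> Q%:R <= q%:R * psi_exp eps q ->
  ln (N%:R : R) <= (4 + 2 * (3 + eps)) * q%:R `^ (1 / (3 + eps)).
Proof.
move=> e0 q0 Q0 NQ Qq.
have q0R : 0 < q%:R :> R by rewrite ltr0n.
have r0 : 0 < 3 + eps by lra.
set y := q%:R `^ _.
have y1 : 1 <= y.
  have -> : 1 = 1 `^ (1 / (3 + eps)) :> R by rewrite powR1.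
  rewrite ge0_ler_powR ?nnegrE ?ler0n ?ler1n//.
  by rewrite divr_ge0// ltW.
have y0 : 0 < y by lra.
have lnq : ln (q%:R : R) <= (3 + eps) * y.
  have -> : ln (q%:R : R) = (3 + eps) * ln y.
    by rewrite ln_powR mulrA mulrCA divff ?gt_eqF// mulr1 mul1r.
  rewrite ler_pM2l// -[y in ln y](subrK 1) addrC.
  by apply: le_trans (le_ln1Dx _) _; lra.
have Nb : (N%:R : R) <= 4 * (q%:R * expR y) ^+ 2.
  have QQ : (N%:R : R) <= (2 * Q%:R) ^+ 2.
    by rewrite -natrM -natrX ler_nat; nia.
  apply: le_trans QQ _; rewrite exprMn -natrX.
  by rewrite ler_pM2l// ler_sqr ?nnegrE ?mulr_ge0 ?ler0n ?expR_ge0.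
have [->|N0] := posnP N; first by rewrite ln0// mulr_ge0//; lra.
have pos : 0 < q%:R * expR y by rewrite mulr_gt0 ?expR_gt0.
have : ln (N%:R : R) <= ln (4 * (q%:R * expR y) ^+ 2).
  by rewrite ler_ln ?posrE ?ltr0n// mulr_gt0 ?exprn_gt0.
have -> : ln (4 * (q%:R * expR y) ^+ 2) = 2 * (ln 2 + (ln q%:R + y)) :> R.
  have -> : 4 * (q%:R * expR y) ^+ 2 = (2 * (q%:R * expR y)) ^+ 2 :> R by ring.
  have pos2 : 0 < 2 * (q%:R * expR y) by rewrite mulr_gt0.
  rewrite (lnXn 2 pos2) lnM ?posrE// lnM ?posrE ?expR_gt0//.
  by rewrite expRK mulr_natl.
move=> /le_trans; apply.
have ln2 : ln (2 : R) <= 1.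
  by have := @le_ln1Dx R 1; rewrite -[1 + 1]/2; apply; lra.
rewrite mulrDl; lra.
Qed.

(** * The discrepancy estimate *)

Theorem proposition3p1 (R : realType) (eps alpha : R) (heps : 0 < eps)
    (halpha : of_type_lt (psi_exp eps) alpha) :
  (fun N : nat => kronecker_discrepancy N alpha : R^o) =O_\oo
  (fun N : nat => 1 / (ln N%:R `^ (3 + eps / 3)) : R^o).
Proof.
have [_ htype] := halpha.
pose r : R := 3 + eps; have r0 : 0 < r by rewrite /r; lra.
pose K : R := 4 + 2 * r; have K0 : 0 < K by rewrite /K; lra.
apply/eqO_exP; exists (14 * K `^ r); first by rewrite mulr_gt0 ?powR_gt0.
near=> N.
(* [N >= e] makes [ln N >= 1], so that its powers increase with the exponent. *)
have eN : expR 1 <= N%:R :> R.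
  apply: ltW; apply: lt_le_trans (truncnS_gt (expR 1)) _; rewrite ler_nat.
  by near: N; exact: nbhs_infty_ge.
have N0 : 0 < N%:R :> R by exact: lt_le_trans (expR_gt0 1) eN.
have lnN : 1 <= ln (N%:R : R).
  by rewrite -[leLHS]expRK ler_ln ?posrE ?expR_gt0.
pose Q := Num.trunc (Num.sqrt (N%:R : R)).
have /andP[Q1 Q2] : Q%:R <= Num.sqrt (N%:R : R) < Q.+1%:R.
  by apply: truncn_itv; exact: sqrtr_ge0.
have sN : Num.sqrt (N%:R : R) ^+ 2 = N%:R by rewrite sqr_sqrtr.
have QN : (Q ^ 2 <= N)%N.
  by rewrite -(ler_nat R) natrX -sN ler_sqr ?nnegrE ?sqrtr_ge0.
have NQ : (N < Q.+1 ^ 2)%N.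
  by rewrite -(ltr_nat R) natrX -sN ltr_sqr ?nnegrE ?sqrtr_ge0.
have Q0 : (0 < Q)%N by case: (Q) NQ => //; move: N0; rewrite ltr0n; lia.
have [q [p [q0 qQ qp qap]]] := dirichlet_approximation alpha Q0.
have q0R : 0 < q%:R :> R by rewrite ltr0n.
have Q0R : 0 < Q%:R :> R by rewrite ltr0n.
have D : kronecker_discrepancy N alpha <= 14 / q%:R.
  apply: (@kronecker_discrepancy_le _ _ _ p) => //.
    by apply: le_trans (ltW qap) _; rewrite lef_pV2 ?posrE// ler_nat.
  by apply: leq_trans QN; rewrite leq_sqr.
have D0 : 0 <= kronecker_discrepancy N alpha.
  have hs := has_sup_deviations N (fun n => frac_part (n%:R * alpha)).
  have [d dD] := hs.1; apply: (@le_trans _ _ d); last exact: (ub_le_sup hs.2).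
  by case: dD => a [b [_ _ _ ->]].
have Qq : Q%:R <= q%:R * psi_exp eps q.
  have psi0 : 0 < psi_exp eps q by exact: expR_gt0.
  have := htype q q0; have [_ /(_ p) dp] := dist_intP (q%:R * alpha).
  rewrite ler_pdivrMr// => h.
  have h2 : q%:R * dist_int (q%:R * alpha) * psi_exp eps q <=
      q%:R * Q%:R^-1 * psi_exp eps q.
    by rewrite ler_pM2r// ler_pM2l// (le_trans dp)// ltW.
  have := le_trans h h2.
  by rewrite mulrAC ler_pdivlMr// mul1r.
have lnq := ln_le_type_denominator heps q0 Q0 NQ Qq.
rewrite -/r -/K in lnq.
have lnr : ln N%:R `^ (3 + eps / 3) <= K `^ r * q%:R.
  apply: (@le_trans _ _ (ln N%:R `^ r)).
    by apply: ler_powR => //; rewrite /r; lra.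
  apply: (@le_trans _ _ ((K * q%:R `^ (1 / r)) `^ r)).
    apply: ge0_ler_powR; rewrite ?nnegrE ?mulr_ge0 ?powR_ge0 ?(ltW r0) ?(ltW K0)//.
    by lra.
  rewrite powRM ?powR_ge0 ?(ltW K0)// -powRrM mul1r mulVf ?gt_eqF//.
  by rewrite powRr1 ?ler0n.
have L0 : 0 < ln N%:R `^ (3 + eps / 3) by rewrite powR_gt0//; lra.
rewrite ger0_norm// ger0_norm ?divr_ge0 ?powR_ge0//.
apply: le_trans D _.
rewrite mul1r -mulrA ler_pM2l// ler_pdivlMr// mulrC.
by rewrite ler_pdivrMr.
Unshelve. all: by end_near.
Qed.
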